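(* Let $p \ge 1$ be an integer, let $1 \le s \le p$ be an integer, and let $y \in \mathbb{R}^p$ with $y \neq 0$. Consider the optimization problem $$\min_{\beta \in \mathbb{R}^p} \ \frac{1}{2}\|y - \beta\|_2^2 \quad \text{subject to} \quad \|\beta\|_0 \le s, \ \ \|\beta\|_2 = 1 .$$ Then the vector obtained by normalized hard-thresholding, $$\hat\beta = \mathcal{H}^\circ(y; s) = \frac{\mathcal{H}(y; s)}{\|\mathcal{H}(y; s)\|_2},$$ is a global optimizer of this problem.
   Context: For $\beta \in \mathbb{R}^p$, $\|\beta\|_0$ denotes the number of nonzero entries of $\beta$ and $\|\beta\|_2$ the Euclidean norm. The hard-thresholding operator $\mathcal{H}(\cdot; s)$ with cardinality $s$ is defined by $\mathcal{H}(y; s) = z$, where $z_i = y_i$ if $|y_i|$ is among the $s$ largest of $|y_1|, \ldots, |y_p|$, and $z_i = 0$ otherwise; in case of ties, an arbitrary set of exactly $s$ indices carrying the $s$ largest absolute values is selected. The normalized hard-thresholding operator is $\mathcal{H}^\circ(y; s) = \mathcal{H}(y; s)/\|\mathcal{H}(y; s)\|_2$ whenever $\|\mathcal{H}(y; s)\|_2 \neq 0$. *)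

(* Defs.v *)
From mathcomp Require Import all_boot all_order all_algebra.
From mathcomp Require Import reals.
Set Implicit Arguments.
Unset Strict Implicit.
Unset Printing Implicit Defensive.
Import Order.TTheory GRing.Theory Num.Theory.
Local Open Scope ring_scope.

Definition l0norm (R : realType) (p : nat) (b : 'cV[R]_p) : nat :=
  #|[set i | b i 0 != 0]|.

(* The norm that MathComp-Analysis puts on matrices is the sup norm, hence
   this explicit Euclidean norm. *)
Definition l2norm (R : realType) (p : nat) (b : 'cV[R]_p) : R :=
  Num.sqrt (\sum_i b i 0 ^+ 2).

Definition top_abs (R : realType) (p : nat) (s : nat) (y : 'cV[R]_p)
    (S : {set 'I_p}) : Prop :=
  #|S| = s /\ forall i j, i \in S -> j \notin S -> `|y j 0| <= `|y i 0|.

(* Ties among the absolute values are broken arbitrarily, so hard thresholding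
   is a relation: z ranges over all the possible values of H(y; s). *)
Definition hard_threshold (R : realType) (p : nat) (s : nat)
    (y z : 'cV[R]_p) : Prop :=
  exists2 S : {set 'I_p}, top_abs s y S &
    z = \col_i (if i \in S then y i 0 else 0).

(* Meaningful only when l2norm z != 0; it is the zero vector otherwise. *)
Definition l2normalize (R : realType) (p : nat) (z : 'cV[R]_p) : 'cV[R]_p :=
  (l2norm z)^-1 *: z.

Definition is_global_minimizer (R : realType) (T : Type)
    (feasible : T -> Prop) (f : T -> R) (x : T) : Prop :=
  feasible x /\ forall x', feasible x' -> f x <= f x'.

Lemma hard_threshold_exists (R : realType) (p s : nat) (y : 'cV[R]_p) :
  (s <= p)%N -> exists z, hard_threshold s y z.
Proof.
move=> le_sp; suff [S topS] : exists S, top_abs s y S by eexists; exists S.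
elim: s le_sp => [|s IHs] lt_sp.
  by exists set0; split=> [|i j]; [exact: cards0 | rewrite inE].
have [S [cardS topS]] := IHs (ltnW lt_sp).
have [k0 k0S] : exists k, k \in ~: S.
  by apply/set0Pn; rewrite -card_gt0 cardsCs setCK cardS card_ord subn_gt0.
have [k kS kmax] := @Order.TotalTheory.arg_maxP _ _ _ k0 (fun i => i \in ~: S)
  (fun i => `|y i 0|) k0S.
rewrite inE in kS; exists (k |: S); split=> [|i j].
  by rewrite cardsU1 kS cardS.
rewrite !inE negb_or => /orP[/eqP-> | iS] /andP[_ jS]; last exact: topS.
by apply: kmax; rewrite inE.
Qed.

(* Main.v *)
(* On the unit sphere, minimizing |y - b| amounts to maximizing <y, b>. If T is
   the support of b, then for n = |H(y; s)| > 0 summing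
   2 n y_i b_i <= y_i^2 + n^2 b_i^2 over T bounds 2 n <y, b> by
   (sum of y_i^2 over T) + n^2 <= 2 n^2, as the s largest |y_i| carry the
   largest sum of squares. The value n is attained by b = H(y; s) / n. *)
Require Import Defs.
From mathcomp Require Import all_boot all_order all_algebra.
From mathcomp Require Import reals.
From mathcomp Require Import ring.
Set Implicit Arguments.
Unset Strict Implicit.
Unset Printing Implicit Defensive.
Import Order.TTheory GRing.Theory Num.Theory.
Local Open Scope ring_scope.

(** The part common to [S] and [T] cancels. What remains of [T] has no more elements than what
    remains of [S], and each value of [f] there is at most each value on [S :\: T]. *)
Lemma ler_sum_top (R : realDomainType) (I : finType) (f : I -> R)
    (S T : {set I}) :
  (forall i, 0 <= f i) -> (#|T| <= #|S|)%N ->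
  (forall i j, i \in S -> j \notin S -> f j <= f i) ->
  \sum_(i in T) f i <= \sum_(i in S) f i.
Proof.
move=> f_ge0 leTS topS.
rewrite (big_setID S) [leRHS](big_setID T) /= setIC lerD2l.
have leD : (#|T :\: S| <= #|S :\: T|)%N.
  by rewrite !cardsD (setIC S) leq_sub2r.
have [->|[j0 j0TS]] := set_0Vmem (T :\: S).
  by rewrite big_set0 sumr_ge0.
(* The maximum [f j] over [T :\: S] separates the two remainders: it dominates the terms of one sum
   and, since [j] lies outside [S], is dominated by those of the other. Passing between the
   cardinalities uses [0 <= f j]. *)
have [j jTS jmax] := @Order.TotalTheory.arg_maxP _ _ _ j0 (fun i => i \in T :\: S)
  f j0TS.
have jNS : j \notin S by case/setDP: jTS.
apply: (@le_trans _ _ (f j *+ #|T :\: S|)).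
  by rewrite -sumr_const ler_sum.
apply: (@le_trans _ _ (f j *+ #|S :\: T|)).
  exact: ler_wpMn2l.
by rewrite -sumr_const ler_sum // => i /setDP[iS _]; exact: topS.
Qed.

Lemma sqr_l2norm (R : realType) (p : nat) (b : 'cV[R]_p) :
  l2norm b ^+ 2 = \sum_i b i 0 ^+ 2.
Proof. by rewrite sqr_sqrtr // sumr_ge0 // => i _; exact: sqr_ge0. Qed.

Lemma sqr_l2normB (R : realType) (p : nat) (y b : 'cV[R]_p) :
  l2norm (y - b) ^+ 2 =
  l2norm y ^+ 2 + l2norm b ^+ 2 - 2 * \sum_i y i 0 * b i 0.
Proof.
rewrite !sqr_l2norm mulr_sumr -big_split -sumrB /=.
by apply: eq_bigr => i _; rewrite !mxE; ring.
Qed.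

Lemma l2norm_normalize (R : realType) (p : nat) (z : 'cV[R]_p) :
  l2norm z != 0 -> l2norm (l2normalize z) = 1.
Proof.
move=> z_neq0; apply/eqP; rewrite -sqrp_eq1 ?sqrtr_ge0 // sqr_l2norm.
under eq_bigr => i _ do rewrite mxE exprMn.
by rewrite -mulr_sumr -sqr_l2norm exprVn mulVf // sqrf_eq0.
Qed.

Lemma sum_sqr_le_hard_threshold (R : realType) (p s : nat) (y z : 'cV[R]_p)
    (T : {set 'I_p}) :
  hard_threshold s y z -> (#|T| <= s)%N ->
  \sum_(i in T) y i 0 ^+ 2 <= l2norm z ^+ 2.
Proof.
case=> S [cardS topS] -> leTs.
have -> : l2norm (\col_i (if i \in S then y i 0 else 0)) ^+ 2 =
          \sum_(i in S) y i 0 ^+ 2.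
  rewrite sqr_l2norm [RHS]big_mkcond; apply: eq_bigr => i _.
  by rewrite mxE; case: ifP => // _; rewrite expr0n.
apply: ler_sum_top => [i||i j iS jS]; rewrite ?sqr_ge0 ?cardS //.
(* Squares are rewritten as squares of absolute values, the quantities that [topS] compares. *)
by rewrite -[leLHS]real_normK ?num_real // -[leRHS]real_normK ?num_real //
  lerXn2r ?nnegrE ?topS.
Qed.

(** For a nonzero entry [y k 0], the singleton [[set k]] has at most [s] elements, so the positive
    number [y k 0 ^+ 2] is at most [l2norm z ^+ 2]. *)
Lemma l2norm_hard_threshold_neq0 (R : realType) (p s : nat) (y z : 'cV[R]_p) :
  (1 <= s)%N -> y != 0 -> hard_threshold s y z -> l2norm z != 0.
Proof.
move=> s_gt0 /cV0Pn[k yk0] /sum_sqr_le_hard_threshold - /(_ [set k]).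
rewrite cards1 big_set1 => /(_ s_gt0) le_yz.
by rewrite -sqrf_eq0 gt_eqF // (lt_le_trans _ le_yz) // exprn_even_gt0.
Qed.

Lemma l0norm_hard_threshold (R : realType) (p s : nat) (y z : 'cV[R]_p) (a : R) :
  hard_threshold s y z -> (l0norm (a *: z) <= s)%N.
Proof.
case=> S [<- _] ->; apply/subset_leq_card/subsetP => i.
by rewrite !inE !mxE; case: ifP => // _; rewrite mulr0 eqxx.
Qed.

Lemma dot_hard_threshold (R : realType) (p s : nat) (y z : 'cV[R]_p) :
  hard_threshold s y z -> \sum_i y i 0 * z i 0 = l2norm z ^+ 2.
Proof.
case=> S _ ->; rewrite sqr_l2norm; apply: eq_bigr => i _.
by rewrite mxE; case: ifP => // _; rewrite mulr0 expr0n.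
Qed.

Lemma dot_le_hard_threshold (R : realType) (p s : nat) (y z b : 'cV[R]_p) :
  hard_threshold s y z -> l2norm z != 0 -> (l0norm b <= s)%N ->
  l2norm b = 1 -> \sum_i y i 0 * b i 0 <= l2norm z.
Proof.
move=> hz z_neq0 b0 b1; set n := l2norm z.
have n_gt0 : 0 < n by rewrite lt0r z_neq0 sqrtr_ge0.
(* By unfolding [l0norm], [b0] bounds the cardinality of the support of [b], which is the set [T]
   here. *)
have le_yz := sum_sqr_le_hard_threshold hz b0.
rewrite -(ler_pM2l (_ : 0 < 2 * n)) ?mulr_gt0 //.
have -> : 2 * n * n = n ^+ 2 + n ^+ 2 * l2norm b ^+ 2 by rewrite b1; ring.
rewrite sqr_l2norm; apply: le_trans (lerD le_yz (lexx _)).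
rewrite !mulr_sumr [X in _ <= X + _]big_mkcond -big_split /=.
apply: ler_sum => i _; rewrite inE.
(* Off the support of [b] both sides vanish; on it their difference is a perfect square. *)
have [->|_] := eqVneq (b i 0) 0; first by rewrite expr0n !mulr0 addr0.
rewrite -subr_ge0.
by have -> : y i 0 ^+ 2 + n ^+ 2 * b i 0 ^+ 2 - 2 * n * (y i 0 * b i 0) =
  (y i 0 - n * b i 0) ^+ 2 by [ring]; exact: sqr_ge0.
Qed.

Theorem theorem1 (R : realType) (p s : nat) (y z : 'cV[R]_p)
    (hp : (1 <= p)%N) (hs1 : (1 <= s)%N) (hsp : (s <= p)%N)
    (hy : y != 0) (hz : hard_threshold s y z) :
  l2norm z != 0 /\
  is_global_minimizer
    (fun b : 'cV[R]_p => (l0norm b <= s)%N /\ l2norm b = 1)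
    (fun b : 'cV[R]_p => 2^-1 * l2norm (y - b) ^+ 2)
    (l2normalize z).
Proof.
have z_neq0 := l2norm_hard_threshold_neq0 hs1 hy hz.
split=> //; split=> [|b [b0 b1]].
  by split; [exact: l0norm_hard_threshold hz | exact: l2norm_normalize].
(* Both competitors have norm 1, so expanding the squares leaves only the inner products with [y] to
   compare. *)
rewrite ler_pM2l ?invr_gt0 // !sqr_l2normB l2norm_normalize // b1.
rewrite lerD2l lerN2 ler_pM2l //.
have -> : \sum_i y i 0 * l2normalize z i 0 = l2norm z.
  under eq_bigr => i _ do rewrite mxE mulrCA.
  by rewrite -mulr_sumr (dot_hard_threshold hz) expr2 mulKf.
exact: dot_le_hard_threshold hz z_neq0 b0 b1.
Qed.
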